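(* Let $a\in\mathbb{R}$, let $1<\nu<2$, and let $f:\mathbb{N}_{a-1}\to\mathbb{R}$. Assume that $\nabla_{a-1}^{\nu} f(t)\ge 0$ for each $t\in\mathbb{N}_{a+4}$. If $$f(a+3)\ge \frac{\nu}{k}f(a+2)+\frac{(k-\nu)\nu}{k(k+1)}f(a+1)+\frac{(k+1-\nu)(k-\nu)\nu}{(k+1)(k+2)k}f(a)\quad\text{for each } k\in\mathbb{N}_2,$$ then $\nabla f(t)\ge 0$ for all $t\in\mathbb{N}_{a+4}$.
   Context: For a real number $c$, $\mathbb{N}_c=\{c,c+1,c+2,\dots\}$. $\nabla f(t)=f(t)-f(t-1)$, $\nabla^m=\nabla(\nabla^{m-1})$, $\rho(s)=s-1$. The rising function is $x^{\overline{\beta}}=\Gamma(x+\beta)/\Gamma(x)$. The nabla left fractional sum of order $\beta>0$ starting from $c$ is $\nabla_c^{-\beta}f(t)=\frac{1}{\Gamma(\beta)}\sum_{s=c+1}^{t}(t-\rho(s))^{\overline{\beta-1}}f(s)$, with empty sums equal to $0$. The nabla left (Riemann) fractional difference of noninteger order $\nu>0$ starting from $c$, with $n=[\nu]+1$ ($[\nu]$ the integer part), is $\nabla_c^{\nu}f(t)=\nabla^n\nabla_c^{-(n-\nu)}f(t)$ for $t\in\mathbb{N}_{c+1}$; equivalently, $\nabla_c^{\nu}f(t)=\frac{1}{\Gamma(-\nu)}\sum_{s=c+1}^{t}(t-\rho(s))^{\overline{-\nu-1}}f(s)$ for $t\in\mathbb{N}_{c+1}$. Here it is used with $c=a-1$.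 *)

(* Defs.v *)
From HB Require Import structures.
From mathcomp Require Import all_boot all_order all_algebra.
From mathcomp Require Import all_classical all_reals all_analysis.
Set Implicit Arguments.
Unset Strict Implicit.
Unset Printing Implicit Defensive.
Import Order.TTheory GRing.Theory Num.Theory.
Import numFieldNormedType.Exports.
Local Open Scope classical_set_scope.
Local Open Scope ring_scope.

Section NablaFractional.
Context {R : realType}.
Implicit Types (a c t z x beta nu : R) (f : R -> R).

Definition Nfrom c : set R := [set t | exists n : nat, t = c + n%:R].

(* Meaningful for 0 < z only. *)
Definition gamma_integral z : R :=
  Rintegral lebesgue_measure `]0, +oo[ (fun x : R => x `^ (z - 1) * expR (- x)).

(* Euler's integral for z > 0, extended to z <= 0 by
   Gamma(z) = Gamma(z + m) / (z (z + 1) ... (z + m - 1)), with m the least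
   natural number such that z + m > 0.  At the poles 0, -1, -2, ... the product
   vanishes, so gamma z = 0 and hence (gamma z)^-1 = 0, which is the usual
   convention for 1 / Gamma. *)
Definition gamma z : R :=
  let m := if 0 < z then 0%N else (Num.truncn (- z)).+1 in
  gamma_integral (z + m%:R) / \prod_(i < m) (z + i%:R).

Definition rising x beta : R := gamma (x + beta) / gamma x.

(* Functions on Nfrom c are represented by functions on R, whose values outside
   Nfrom c play no role. *)
Definition nabla f t : R := f t - f (t - 1).

Definition rho (s : R) : R := s - 1.

(* For t in Nfrom c, the points s = c + 1, ..., t are the c + i with
   1 <= i <= t - c.  The sum is empty if t < c + 1, since truncn is 0 on
   negative numbers. *)
Definition nabla_sum c beta f t : R :=
  (gamma beta)^-1 *
  \sum_(1 <= i < (Num.truncn (t - c)).+1)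
     rising (t - rho (c + i%:R)) (beta - 1) * f (c + i%:R).

Definition nabla_diff c nu f t : R :=
  let n := (Num.truncn nu).+1 in
  iter n nabla (nabla_sum c (n%:R - nu) f) t.

End NablaFractional.

(* Main.v *)
Require Import Defs.
From HB Require Import structures.
From mathcomp Require Import all_boot all_order all_algebra.
From mathcomp Require Import all_classical all_reals all_analysis.
From mathcomp Require Import measurable_realfun lra ring zify.
Import Order.TTheory GRing.Theory Num.Theory.
Import numFieldNormedType.Exports.
Local Open Scope classical_set_scope.
Local Open Scope ring_scope.

(** Euler's recursion for [gamma] turns the nabla fractional sum of order beta
    into the convolution with the coefficients of (1 - x)^(-beta), and [nabla]
    into multiplication by 1 - x, so the fractional difference of order nu is
    the convolution of f with the coefficients of (1 - x)^nu, that is, of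
    [nabla f] with those of (1 - x)^(nu - 1).  The latter are 1 followed by
    negative numbers u_1, u_2, ..., so the fractional difference being
    nonnegative bounds [nabla f (t)] from below by a combination with
    nonnegative coefficients of its previous values.  Strong induction
    concludes, once the contribution of f(a), ..., f(a + 3) is known to be
    nonnegative: divided by -u_(k - 1) it is exactly f(a + 3) minus the
    left-hand side of the hypothesis at k. *)

(* The coefficient of x^m in (1 - x)^(- al). *)
Definition binc {F : fieldType} (al : F) (m : nat) : F :=
  \prod_(i < m) ((al + i%:R) / i.+1%:R).

(* The value g 0 is never used. *)
Definition conv {F : fieldType} (al : F) (g : nat -> F) (N : nat) : F :=
  \sum_(i < N) binc al (N - i.+1) * g i.+1.

(** * Generating-function identities, signs, and the induction on convolutions *)

Section Binomial_coefficients.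
Context {R : realFieldType}.
Implicit Types (al : R) (g : nat -> R).

Lemma binc0 al : binc al 0 = 1.
Proof. by rewrite /binc big_ord0. Qed.

Lemma bincS al m : binc al m.+1 = binc al m * ((al + m%:R) / m.+1%:R).
Proof. by rewrite /binc big_ord_recr. Qed.

(** Coefficient of x^(m + 1) in (1 - x)^(1 - al) = (1 - x) (1 - x)^(- al). *)
Lemma binc_pred al m : binc (al - 1) m.+1 = binc al m.+1 - binc al m.
Proof.
suff -> : binc (al - 1) m.+1 = binc al m * ((al - 1) / m.+1%:R).
  by rewrite bincS; field; rewrite nat1r pnatr_eq0.
elim: m => [|m IH]; first by rewrite bincS !binc0 addr0.
by rewrite bincS IH (bincS al m) -natr1; field;
  rewrite -natrD natr1 !pnatr_eq0.
Qed.

Lemma conv_nabla al g N : conv al g N.+1 - conv al g N = conv (al - 1) g N.+1.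
Proof.
rewrite /conv !big_ord_recr/= !subnn !binc0 addrAC -sumrB; congr (_ + _).
apply: eq_bigr => -[i iN] _ /=.
by rewrite subSn// binc_pred mulrBl.
Qed.

(** Summation by parts: the factor 1 - x moves from the coefficients onto [g]; [g 0 = 0] makes the
    first difference equal to [g 1]. *)
Lemma conv_nabla_fun al g N : g 0%N = 0 ->
  conv (al - 1) g N = conv al (fun i => g i - g i.-1) N.
Proof.
move=> g0; case: N => [|N]; first by rewrite /conv !big_ord0.
rewrite -conv_nabla /conv [in LHS]big_ord_recr/= subnn binc0.
under [RHS]eq_bigr do rewrite mulrBr /=.
rewrite sumrB big_ord_recr/= subnn binc0; congr (_ + _ - _).
rewrite [RHS]big_ord_recl/= g0 mulr0 add0r.
by apply: eq_bigr => i _; rewrite /bump /= add1n subSS.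
Qed.

(** Only the first factor of the product, [al] itself, is negative. *)
Lemma binc_lt0 al m : -1 < al < 0 -> binc al m.+1 < 0.
Proof.
move=> /andP[a1 a0]; elim: m => [|m IH].
  by rewrite bincS binc0 addr0 mul1r divr1.
rewrite bincS nmulr_rlt0// divr_gt0 ?ltr0n//.
by rewrite -natr1; have : 0 <= m%:R :> R by []; lra.
Qed.

(** Each coefficient is the previous one times (j + 1 - nu) / (j + 1), so [binc (1 - nu) m.+1]
    factors out; the ratios that occur have denominators k, k + 1 and k + 2. *)
Lemma binc_boundary (nu k : R) g m : m.+2%:R = k -> g 0%N = 0 ->
  \sum_(i < 4) binc (1 - nu) (m.+1 + 4 - i.+1) * (g i.+1 - g i) =
  binc (1 - nu) m.+1 * (g 4%N - (nu / k * g 3%N + (k - nu) * nu / (k * (k + 1)) * g 2%N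
     + (k + 1 - nu) * (k - nu) * nu / ((k + 1) * (k + 2) * k) * g 1%N)).
Proof.
move=> mk g0.
have k0 : 0 < k by rewrite -mk.
have uS j : binc (1 - nu) j.+1 = binc (1 - nu) j * ((j.+1%:R - nu) / j.+1%:R).
  by rewrite bincS -natr1; congr (_ * (_ / _)); ring.
have e3 : m.+3%:R = k + 1 by rewrite -natr1 mk.
have e4 : m.+4%:R = k + 2 by rewrite -natr1 e3; ring.
rewrite !big_ord_recl big_ord0 /= g0 /bump /= !subnE /= !addn4 /=.
rewrite (uS m.+3) (uS m.+2) (uS m.+1) e4 e3 mk.
set u := binc _ _; clearbody u.
by field; rewrite !lt0r_neq0//; lra.
Qed.

Lemma ge0_of_conv_ge0 (al : R) (D : nat -> R) :
  (forall m, binc al m.+1 < 0) ->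
  (forall N, (5 <= N)%N -> 0 <= conv al D N) ->
  (forall m, \sum_(i < 4) binc al (m.+1 + 4 - i.+1) * D i.+1 <= 0) ->
  forall N, (5 <= N)%N -> 0 <= D N.
Proof.
move=> u_lt0 convD_ge0 boundary; elim/ltn_ind => N IH N5.
have [m Nm] : exists m, N = (4 + m).+1 by exists (N - 5)%N; lia.
have {N5} := convD_ge0 N N5.
rewrite Nm /conv big_ord_recr/= subnn binc0 mul1r => /le_trans; apply.
(* It remains to see that the earlier terms sum to at most 0: the first four by [boundary], the
   others one by one by induction. *)
rewrite gerDr big_split_ord/=.
apply: le_trans (boundary m); rewrite (_ : (m.+1 + 4 = (4 + m).+1)%N); last lia.
rewrite gerDl sumr_le0// => i _.
rewrite subSS subnDl; apply: mulr_le0_ge0.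
  by rewrite -(subnSK (ltn_ord i)) ltW.
by apply: IH; move: (ltn_ord i); lia.
Qed.
End Binomial_coefficients.

(** * Euler's integral: functional equation, finiteness and positivity *)

Section Gamma.
Context {R : realType}.
Implicit Types x z : R.
Local Notation mu := (@lebesgue_measure R).
Local Notation integrand z := (fun x : R => x `^ (z - 1) * expR (- x)).
Local Notation eGamma z :=
  (\int[mu]_(x in `]0%R, +oo[) (x `^ (z - 1) * expR (- x))%:E)%E.
Local Notation itvn n := `[(n.+2%:R : R)^-1, n.+2%:R].

Lemma continuous_expRN : continuous (fun x : R => expR (- x)).
Proof.
by move=> x; apply: continuous_comp; [exact: opp_continuous|exact: continuous_expR].
Qed.

Lemma measurable_gamma_integrand z (D : set R) :
  measurable_fun D (integrand z).
Proof.
apply: measurable_funTS; apply: measurable_funM; first exact: measurable_powR.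
by apply: continuous_measurable_fun; exact: continuous_expRN.
Qed.

Lemma gamma_integrand_ge0 z x : 0 <= x `^ (z - 1) * expR (- x).
Proof. by rewrite mulr_ge0 ?powR_ge0 ?expR_ge0. Qed.

Lemma continuous_powR_gt0 z x : 0 < x -> {for x, continuous (@powR R ^~ z)}.
Proof.
move=> x0; apply: differentiable_continuous; apply/derivable1_diffP.
by apply: derivable_powR; rewrite in_itv/= x0.
Qed.

Lemma within_continuous_gamma_integrand z (a b : R) : 0 < a ->
  {within `[a, b], continuous (integrand z)}.
Proof.
move=> a0; apply: continuous_in_subspaceT => x; rewrite inE/= in_itv/= => /andP[ax _].
apply: cvgM; last exact: continuous_expRN.
exact/continuous_powR_gt0/(lt_le_trans a0).
Qed.

(** Monotone convergence along compact intervals, on which integration by parts applies. *)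
Lemma cvg_eGamma z :
  (\int[mu]_(x in [set` itvn n]) (x `^ (z - 1) * expR (- x))%:E)%E @[n --> \oo]
    --> eGamma z.
Proof.
have -> : `]0, +oo[%classic = \bigcup_n [set` itvn n].
  apply/seteqP; split => x /=.
    rewrite in_itv/= andbT => x0.
    have ix0 : 0 < x^-1 by rewrite invr_gt0.
    (* This index bounds both x and 1 / x, hence serves both endpoints. *)
    exists (Num.truncn (x + x^-1)) => //=; rewrite in_itv/=.
    have h : x + x^-1 < (Num.truncn (x + x^-1)).+2%:R.
      by rewrite (lt_trans (truncnS_gt _))// ltr_nat.
    by apply/andP; split; [rewrite invf_ple ?posrE//|]; lra.
  move=> [n _] /=; rewrite !in_itv/= andbT => /andP[+ _].
  by apply: lt_le_trans; rewrite invr_gt0.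
apply: ge0_nondecreasing_set_cvg_integral.
- move=> m n mn; rewrite subsetEset => x /=; rewrite !in_itv/= => /andP[mx xm].
  apply/andP; split.
    by rewrite (le_trans _ mx)// lef_pV2 ?posrE// ler_nat.
  by rewrite (le_trans xm)// ler_nat.
- by move=> n; exact: measurable_itv.
- by move=> n; apply/measurable_EFinP; exact: measurable_gamma_integrand.
- by move=> n x _; rewrite lee_fin gamma_integrand_ge0.
Qed.

Lemma gamma_parts z (a b : R) : 0 < a -> a < b ->
  (\int[mu]_(x in `[a, b]) (x `^ (z + 1 - 1) * expR (- x))%:E =
   (a `^ z * expR (- a) - b `^ z * expR (- b))%:E +
   z%:E * \int[mu]_(x in `[a, b]) (x `^ (z - 1) * expR (- x))%:E)%E.
Proof.
move=> a0 ab.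
rewrite addrK (@integration_by_parts _ (@powR R ^~ z) (fun x => - expR (- x))
  (fun x => z * x `^ (z - 1)) (fun x => expR (- x)))//.
- congr (_ + _)%E; first by congr EFin; ring.
  rewrite [X in (- X)%E](_ : _ = \int[mu]_(x in `[a, b])
      ((- z)%:E * (x `^ (z - 1) * expR (- x))%:E))%E; last first.
    by apply: eq_integral => x _; rewrite -EFinM; congr EFin; ring.
  rewrite integralZl//.
    by rewrite EFinN mulNe oppeK.
  apply: continuous_compact_integrable; first exact: segment_compact.
  exact: within_continuous_gamma_integrand.
- apply: continuous_in_subspaceT => x; rewrite inE/= in_itv/= => /andP[ax _].
  by apply: cvgMr; exact/continuous_powR_gt0/(lt_le_trans a0).
- split.
  + move=> x; rewrite in_itv/= => /andP[ax _].
    by apply: derivable_powR; rewrite in_itv/= (lt_trans a0).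
  + exact/cvg_at_right_filter/continuous_powR_gt0.
  + exact/cvg_at_left_filter/continuous_powR_gt0/(lt_trans a0).
- move=> x; rewrite in_itv/= => /andP[ax _].
  by apply: powR_derive1; rewrite in_itv/= (lt_trans a0).
- exact/continuous_subspaceT/continuous_expRN.
- split.
  + by move=> x _; exact: ex_derive.
  + by apply/cvg_at_right_filter; apply: cvgN; exact: continuous_expRN.
  + by apply/cvg_at_left_filter; apply: cvgN; exact: continuous_expRN.
- move=> x _; rewrite derive1N// derive1_comp// derive1N// derive1_id derive1E.
  by rewrite derive_val mulrN1 opprK.
Qed.

(* The power z + 1 of the bound exp y >= y at y = x / (z + 1). *)
Lemma expRN_powR_le z x : 0 < z -> 0 < x ->
  x `^ z * expR (- x) <= (z + 1) `^ (z + 1) / x.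
Proof.
move=> z0 x0; have z1 : 0 < z + 1 by lra.
rewrite ler_pdivlMr// expRN mulrAC ler_pdivrMr ?expR_gt0//.
rewrite -[X in _ * X <= _]powRr1 ?(ltW x0)// -powRD; last by rewrite (gt_eqF x0) implybT.
have -> : expR x = expR (x / (z + 1)) `^ (z + 1).
  by rewrite -expRM divfK ?gt_eqF.
rewrite -powRM ?expR_ge0 ?(ltW z1)//.
rewrite (ge0_ler_powR (ltW z1)) ?nnegrE ?mulr_ge0 ?expR_ge0 ?(ltW x0) ?(ltW z1)//.
rewrite mulrC -ler_pdivrMr//; apply: le_trans (expR_ge1Dx _).
by rewrite lerDr.
Qed.

Lemma cvg_invSS : (n.+2%:R^-1 : R) @[n --> \oo] --> (0 : R).
Proof. by have := @cvg_harmonic R; rewrite -cvg_shiftS. Qed.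

Lemma cvg_expRN_powR z : 0 < z ->
  (n.+2%:R : R) `^ z * expR (- n.+2%:R) @[n --> \oo] --> (0 : R).
Proof.
move=> z0; apply: (@squeeze_cvgr _ _ _ _ (cst 0)
  (fun n => (z + 1) `^ (z + 1) * n.+2%:R^-1)).
- near=> n; rewrite mulr_ge0 ?powR_ge0 ?expR_ge0//=.
  exact: expRN_powR_le.
- exact: cvg_cst.
- rewrite -[X in _ --> X](mulr0 ((z + 1) `^ (z + 1))); apply: cvgMr.
  exact: cvg_invSS.
Unshelve. all: by end_near. Qed.

Lemma cvg_expRN_powRV z : 0 < z ->
  (n.+2%:R^-1 : R) `^ z * expR (- n.+2%:R^-1) @[n --> \oo] --> (0 : R).
Proof.
move=> z0.
apply: (@squeeze_cvgr _ _ _ _ (cst 0) (fun n => (n.+2%:R^-1 : R) `^ z)).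
- near=> n; rewrite mulr_ge0 ?powR_ge0 ?expR_ge0//=.
  by rewrite ler_piMr ?powR_ge0// -[leRHS](@expR0 R) ler_expR oppr_le0 invr_ge0.
- exact: cvg_cst.
- have /cvg_at_rightP := powR_cvg0 z0; apply; split => //; exact: cvg_invSS.
Unshelve. all: by end_near. Qed.

Lemma eGamma_ge0 z : (0 <= eGamma z)%E.
Proof. by apply: integral_ge0 => x _; rewrite lee_fin gamma_integrand_ge0. Qed.

(** Limit of [gamma_parts], whose boundary terms vanish at 0 and at infinity. In extended reals no
    finiteness has to be known yet. *)
Lemma eGammaS z : 0 < z -> eGamma (z + 1) = (z%:E * eGamma z)%E.
Proof.
move=> z0; rewrite -[RHS]add0e.
have p1 n : 0 < n.+2%:R^-1 :> R by [].
(* The shift by 2 keeps the interval nondegenerate at n = 0. *)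
have p2 n : n.+2%:R^-1 < n.+2%:R :> R.
  by rewrite (@lt_trans _ _ 1) ?invf_lt1 ?ltr1n.
apply: (cvg_unique _ (cvg_eGamma (z + 1))) => //.
rewrite /mkset (eq_cvg _ _ (fun n => gamma_parts z _ _ (p1 n) (p2 n))).
apply: cvgeD => //.
- apply: cvg_EFin; first by near=> n.
  rewrite -[X in _ --> X](subr0 0); apply: cvgB.
    exact: cvg_expRN_powRV.
  exact: cvg_expRN_powR.
- apply: cvgeZl => //; exact: cvg_eGamma.
Unshelve. all: by end_near. Qed.

(** The exponential density of rate 1 has total mass 1. *)
Lemma eGamma1 : eGamma 1 = 1%E.
Proof.
rewrite -(@integral_exponential_pdf R 1)//.
rewrite integral_itv_obnd_cbnd; last first.
  by apply/measurable_EFinP; exact: measurable_gamma_integrand.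
rewrite integral_mkcond; apply: eq_integral => x _.
rewrite -[X in X \_ _]/(EFin \o integrand 1) restrict_EFin /=; congr EFin.
rewrite /exponential_pdf !patchE; case: ifP => // _.
by rewrite subrr powRr0 mulN1r.
Qed.

(* Integrals of 1 <= x^(z-1) + x^z and x^z <= 1 + x against exp(-x): the first
   makes Gamma(z) nonzero, the second makes it finite. *)
Lemma gamma_bounds z : 0 < z < 1 ->
  (1 <= eGamma z + eGamma (z + 1))%E /\ (eGamma (z + 1) <= eGamma 1 + eGamma (1 + 1))%E.
Proof.
move=> /andP[z0 z1].
have mI w : measurable_fun (`]0, +oo[ : set R) (fun x => (integrand w x)%:E).
  by apply/measurable_EFinP; exact: measurable_gamma_integrand.
have I0 w (x : R) : (0 <= (integrand w x)%:E)%E.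
  by rewrite lee_fin gamma_integrand_ge0.
split; [rewrite -eGamma1|]; (rewrite -ge0_integralD//; try exact: mI);
  apply: ge0_le_integral => //=; try exact: mI.
- by apply: emeasurable_funD; exact: mI.
- move=> x; rewrite in_itv/= andbT => x0.
  rewrite -EFinD lee_fin -mulrDl ler_pM2r ?expR_gt0// !addrK subrr powRr0.
  have [x1|x1] := leP x 1.
    rewrite ler_wpDr ?powR_ge0// -[leLHS](powRr0 x).
    by apply: ger_powR; rewrite ?x0//; lra.
  by rewrite ler_wpDl ?powR_ge0// -[leLHS](powRr0 x) ler_powR// ltW.
- by apply: emeasurable_funD; exact: mI.
- move=> x; rewrite in_itv/= andbT => x0.
  rewrite -EFinD lee_fin -mulrDl ler_pM2r ?expR_gt0// !addrK subrr powRr0.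
  rewrite powRr1 ?(ltW x0)//; have [x1|x1] := leP x 1.
    rewrite ler_wpDr ?(ltW x0)// -[leRHS](powRr0 x).
    by apply: ger_powR; rewrite ?x0//; lra.
  by rewrite ler_wpDl// -[leRHS]powRr1 ?(ltW x0)// ler_powR// ltW.
Qed.

Lemma gamma_gt0E z : 0 < z -> gamma z = fine (eGamma z).
Proof. by move=> z0; rewrite /gamma z0 addr0 big_ord0 divr1. Qed.

Lemma gammaS z : 0 < z -> gamma (z + 1) = z * gamma z.
Proof.
move=> z0; have z1 : 0 < z + 1 by lra.
rewrite (gamma_gt0E _ z1) (gamma_gt0E _ z0) (eGammaS _ z0).
have := eGamma_ge0 z; move: (eGamma z) => [r| |]//= _.
(* If the integral were infinite, both sides would be 0, because [fine] sends +oo to 0. *)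
by rewrite gt0_muley ?lte_fin//= mulr0.
Qed.

Lemma gamma_nat m : gamma (m.+1%:R : R) = m`!%:R.
Proof.
elim: m => [|m IH]; first by rewrite gamma_gt0E ?ltr01// eGamma1.
by rewrite -natr1 gammaS ?ltr0Sn// IH -natrM factS.
Qed.

(** By the functional equation, [gamma_bounds] reads 1 <= (1 + z) Gamma(z) and z Gamma(z) <= 2,
    which exclude 0 and +oo. *)
Lemma gamma_gt0 z : 0 < z < 1 -> 0 < gamma z.
Proof.
move=> z01; have [z0 z1] := andP z01.
have [] := gamma_bounds _ z01.
rewrite (eGammaS _ z0) (eGammaS _ ltr01) eGamma1 mule1 (gamma_gt0E _ z0).
have := eGamma_ge0 z; move: (eGamma z) => [r| |]//=.
  rewrite -EFinM -EFinD !lee_fin => r0 h _.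
  rewrite lt_neqAle r0 andbT; apply/eqP => r00; move: h; rewrite -r00; lra.
by move=> _ _; rewrite gt0_muley ?lte_fin// leye_eq -EFinD.
Qed.

Lemma gammaD_prod (b : R) m : 0 < b ->
  gamma (b + m%:R) = gamma b * \prod_(i < m) (b + i%:R).
Proof.
move=> b0; elim: m => [|m IH]; first by rewrite addr0 big_ord0 mulr1.
rewrite big_ord_recr/= mulrA -IH -natr1 addrA.
by rewrite [LHS]gammaS 1?mulrC// ltr_wpDr.
Qed.

End Gamma.

(** * Fractional sums and differences as convolutions *)

Section Nabla_fractional.
Context {R : realType}.
Implicit Types (c beta nu : R) (f : R -> R) (g : nat -> R).

(** Both sides are Gamma(beta + m) / m!. *)
Lemma rising_binc beta m : 0 < beta ->
  rising (m.+1%:R) (beta - 1) = gamma beta * binc beta m.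
Proof.
move=> beta0; rewrite /rising gamma_nat.
rewrite (_ : m.+1%:R + (beta - 1) = beta + m%:R); last by rewrite -natr1; ring.
rewrite gammaD_prod// -mulrA; congr (_ * _).
by rewrite /binc prodf_div fact_prod big_add1 big_mkord natr_prod.
Qed.

Lemma nabla_sum_conv c beta f g N : 0 < beta < 1 ->
  (forall i, g i.+1 = f (c + i.+1%:R)) ->
  nabla_sum c beta f (c + N%:R) = conv beta g N.
Proof.
move=> beta01 gf; have [beta0 _] := andP beta01.
rewrite /nabla_sum /conv addrAC subrr add0r natrK big_add1/= big_mkord mulr_sumr.
apply: eq_bigr => i _; rewrite -gf.
rewrite (_ : c + N%:R - rho _ = (N - i.+1).+1%:R); last first.
  by rewrite /rho subnSK// natrB ?(ltnW (ltn_ord i))// -natr1; ring.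
(* Cancelling [gamma beta] requires it to be nonzero. *)
by rewrite rising_binc// -mulrA mulKf// gt_eqF// gamma_gt0.
Qed.

(** Here n = 2, so the sum has order 2 - nu in (0, 1), and each of the two nablas lowers the order
    by 1. *)
Lemma nabla_diff_conv c nu f g N : 1 < nu < 2 ->
  (forall i, g i.+1 = f (c + i.+1%:R)) ->
  nabla_diff c nu f (c + N.+2%:R) = conv (- nu) g N.+2.
Proof.
move=> /andP[nu1 nu2] gf.
rewrite /nabla_diff (_ : Num.truncn nu = 1%N); last first.
  by apply/eqP; rewrite truncn_eq ?nu2 ?ltW//; lra.
rewrite /= /nabla.
rewrite (_ : c + N.+2%:R - 1 = c + N.+1%:R); last by rewrite -natr1; ring.
rewrite (_ : c + N.+1%:R - 1 = c + N%:R); last by rewrite -natr1; ring.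
rewrite !(nabla_sum_conv _ _ _ g)//; try lra.
by rewrite !conv_nabla; congr conv; ring.
Qed.

End Nabla_fractional.

Theorem theorem2p9 (R : realType) (a nu : R) (f : R -> R)
  (nu_gt1 : 1 < nu) (nu_lt2 : nu < 2)
  (diff_ge0 : forall t : R, Nfrom (a + 4) t -> 0 <= nabla_diff (a - 1) nu f t)
  (f_ge : forall k : R, Nfrom 2 k ->
     nu / k * f (a + 2)
     + (k - nu) * nu / (k * (k + 1)) * f (a + 1)
     + (k + 1 - nu) * (k - nu) * nu / ((k + 1) * (k + 2) * k) * f a
     <= f (a + 3)) :
  forall t : R, Nfrom (a + 4) t -> 0 <= nabla f t.
Proof.
move=> t [n ->].
(* The sums start at c + 1 = a, which is index 1; the value 0 at index 0 replaces f(a - 1), so that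
   the first difference is f(a). *)
pose g (i : nat) : R := if i is 0%N then 0 else f (a - 1 + i%:R).
have gf i : g i.+1 = f (a - 1 + i.+1%:R) by [].
have nu12 : 1 < nu < 2 by rewrite nu_gt1.
have gE i : g i.+1 = f (a + i%:R) by rewrite gf -natr1; congr f; ring.
have conv_ge0 N : (5 <= N)%N -> 0 <= conv (1 - nu) (fun i => g i - g i.-1) N.
  case: N => [//|[//|N]] N3; rewrite -conv_nabla_fun//.
  rewrite (_ : 1 - nu - 1 = - nu); last by ring.
  rewrite -(nabla_diff_conv (a - 1) nu f)//; apply: diff_ge0.
  exists (N - 3)%N; rewrite natrB// -natr1 -natr1; ring.
have boundary m :
    \sum_(i < 4) binc (1 - nu) (m.+1 + 4 - i.+1) * (g i.+1 - g i) <= 0.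
  rewrite (binc_boundary _ m.+2%:R)// nmulr_rle0 ?binc_lt0; try lra.
  rewrite subr_ge0 !gE addr0; apply: f_ge.
  (* The hypothesis is used at k = m + 2. *)
  by exists m; rewrite -natrD add2n.
have u_lt0 m : binc (1 - nu) m.+1 < 0 by apply: binc_lt0; lra.
(* The point t = a + 4 + n has index n + 5. *)
have : 0 <= g n.+1.+4 - g n.+4.
  exact: (ge0_of_conv_ge0 _ (fun i => g i - g i.-1) u_lt0 conv_ge0 boundary).
rewrite !gE /nabla (_ : a + 4 + n%:R = a + n.+4%:R); last first.
  by rewrite -addrA -natrD.
by rewrite (_ : a + n.+4%:R - 1 = a + n.+3%:R)// -[n.+4%:R]natr1; ring.
Qed.
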